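(* For the complex Banach space $X=\ell_1\oplus_\infty c_0$, the set of numerical radius attaining operators is dense (in operator norm) in $\mathcal{L}(X)$.
   Context: $\mathcal{L}(X)$ is the space of bounded linear operators from $X$ to $X$ with the operator norm. $\ell_1\oplus_\infty c_0$ is $\ell_1\times c_0$ (complex sequence spaces) with norm $\max\{\|x\|_1,\|y\|_\infty\}$. For a Banach space $X$ with unit sphere $S_X$ and dual $X^*$, put $\Pi(X)=\{(x,x^* )\in S_X\times S_{X^*}: x^*(x)=1\}$ and, for $T\in\mathcal{L}(X)$, $\nu(T)=\sup\{|x^*(Tx)|:(x,x^* )\in\Pi(X)\}$ (the numerical radius). $T$ attains its numerical radius if there is $(x_0,x_0^* )\in\Pi(X)$ with $|x_0^*(Tx_0)|=\nu(T)$. *)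

(* Defs.v *)
From HB Require Import structures.
From mathcomp Require Import all_boot all_order all_algebra.
From mathcomp Require Import all_classical all_reals all_analysis.
From mathcomp Require Import complex.

Set Implicit Arguments.
Unset Strict Implicit.
Unset Printing Implicit Defensive.

Import Order.TTheory GRing.Theory Num.Theory.
Import numFieldNormedType.Exports.

Local Open Scope classical_set_scope.
Local Open Scope ring_scope.
Local Open Scope complex_scope.

(* The norm of a normed module over R[i] is an R[i]-valued nonnegative number;
   rnorm is the same number seen in R, where suprema and limits are taken. *)
Definition rnorm (R : realType) (V : normedZmodType R[i]) (v : V) : R :=
  complex.Re `|v|.

Section rnorm_theory.
Context {R : realType}.

Lemma rnormE (V : normedZmodType R[i]) (v : V) : `|v| = (rnorm v)%:C.
Proof.
have := normr_ge0 v; rewrite lecE /= /rnorm => /andP[/eqP].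
by case: `|v| => a b /= ->.
Qed.

Lemma rnorm_ge0 (V : normedZmodType R[i]) (v : V) : 0 <= rnorm v.
Proof. by rewrite -ler0c -rnormE. Qed.

Lemma rnormD (V : normedZmodType R[i]) (v w : V) :
  rnorm (v + w) <= rnorm v + rnorm w.
Proof. by rewrite -lecR rmorphD/= -!rnormE ler_normD. Qed.

Lemma rnorm0 (V : normedZmodType R[i]) : rnorm (0 : V) = 0.
Proof. by rewrite /rnorm normr0. Qed.

Lemma rnorm_eq0 (V : normedZmodType R[i]) (v : V) : rnorm v = 0 -> v = 0.
Proof. by move=> v0; apply/eqP; rewrite -normr_eq0 rnormE v0. Qed.

Lemma rnormZ (V : normedModType R[i]) (a : R[i]) (v : V) :
  rnorm (a *: v) = rnorm a * rnorm v.
Proof. by apply: complexI; rewrite rmorphM/= -!rnormE normrZ. Qed.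

Lemma rnormM (a b : R[i]) : rnorm (a * b) = rnorm a * rnorm b.
Proof. by apply: complexI; rewrite rmorphM/= -!rnormE normrM. Qed.

End rnorm_theory.

Section sup_theory.
Context {R : realType} {I : Type}.

Lemma supM (A : set I) (f : I -> R) (k : R) : 0 <= k -> A !=set0 ->
  has_ubound (f @` A) -> sup [set k * f i | i in A] = k * sup (f @` A).
Proof.
move=> k0 [i0 Ai0] bf; have ne : f @` A !=set0 by exists (f i0), i0.
apply/eqP; rewrite eq_le; apply/andP; split.
  apply: ge_sup; first by exists (k * f i0), i0.
  move=> _ [i Ai <-]; apply: ler_wpM2l => //.
  by apply: ub_le_sup => //; exists i.
have [k1|k1] := eqVneq k 0.
  rewrite k1 mul0r; apply: ub_le_sup; last by exists i0 => //; rewrite mul0r.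
  by exists 0 => _ [i Ai <-]; rewrite mul0r.
have {k1}k0 : 0 < k by rewrite lt_neqAle eq_sym k1.
rewrite -ler_pdivlMl//; apply: ge_sup => // _ [i Ai <-].
rewrite ler_pdivlMl//; apply: ub_le_sup; last by exists i.
case: bf => M bM; exists (k * M) => _ [j Aj <-].
apply: ler_wpM2l; first exact: ltW.
by apply: bM; exists j.
Qed.

End sup_theory.

Section bounded_linear_operators.
Context {R : realType}.
Variables V W : normedModType R[i].

Definition bounded_linear : {pred V -> W} := fun f : V -> W =>
  `[< linear f /\ exists M : R, forall x, rnorm (f x) <= M * rnorm x >].

Record blop := Blop { blop_val :> V -> W; blop_valP : blop_val \in bounded_linear }.

HB.instance Definition _ := [isSub for blop_val].
HB.instance Definition _ := gen_eqMixin blop.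
HB.instance Definition _ := gen_choiceMixin blop.

Lemma bounded_linearP (f : V -> W) : f \in bounded_linear <->
  linear f /\ exists M : R, forall x, rnorm (f x) <= M * rnorm x.
Proof. by split => [/asboolP|?]//; exact/asboolP. Qed.

Lemma bounded_linear_submod_closed : submod_closed bounded_linear.
Proof.
split => [|a f g /bounded_linearP[lf [M fM]] /bounded_linearP[lg [N gN]]].
  apply/bounded_linearP; split => [k x y|]; first by rewrite /= scaler0 addr0.
  by exists 0 => x; rewrite mul0r /= rnorm0.
apply/bounded_linearP; split => [k x y|].
  rewrite !fctE /= lf lg !scalerDr !scalerA mulrC -!addrA; congr (_ + _).
  by rewrite addrCA.
exists (rnorm a * M + N) => x; rewrite !fctE /=.
apply: le_trans (rnormD _ _) _; rewrite mulrDl lerD//.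
by rewrite rnormZ -mulrA ler_wpM2l// rnorm_ge0.
Qed.

HB.instance Definition _ :=
  GRing.isSubmodClosed.Build _ _ bounded_linear bounded_linear_submod_closed.
HB.instance Definition _ := [SubChoice_isSubLmodule of blop by <:].

Definition opnorm (f : blop) : R :=
  sup [set rnorm (f x) | x in [set x | rnorm x <= 1]].

Lemma blop_linear (f : blop) : linear f.
Proof. by have /bounded_linearP[] := blop_valP f. Qed.

Lemma opnorm_has_ubound (f : blop) :
  has_ubound [set rnorm (f x) | x in [set x | rnorm x <= 1]].
Proof.
have /bounded_linearP[_ [M fM]] := blop_valP f.
exists `|M| => _ [x /= x1 <-]; apply: le_trans (fM x) _.
apply: (@le_trans _ _ (`|M| * rnorm x)).
  by rewrite ler_wpM2r ?rnorm_ge0 ?ler_norm.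
by rewrite ler_piMr.
Qed.

Lemma rnorm_ball0 : [set x : V | rnorm x <= 1] !=set0.
Proof. by exists 0; rewrite /= rnorm0. Qed.

Lemma le_opnorm1 (f : blop) x : rnorm x <= 1 -> rnorm (f x) <= opnorm f.
Proof.
move=> x1; apply: ub_le_sup; first exact: opnorm_has_ubound.
by exists x.
Qed.

Lemma opnormD (f g : blop) : (opnorm (f + g))%:C <= (opnorm f)%:C + (opnorm g)%:C.
Proof.
rewrite -rmorphD /= lecR; apply: ge_sup.
  by have [x x1] := rnorm_ball0; exists (rnorm ((f + g) x)), x.
move=> _ [x x1 <-]; apply: le_trans (rnormD _ _) _.
by rewrite lerD// le_opnorm1.
Qed.

Lemma opnormZ (a : R[i]) (f : blop) :
  (opnorm (a *: f))%:C = `|a| * (opnorm f)%:C.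
Proof.
rewrite rnormE -rmorphM /=; congr (_ %:C); rewrite /opnorm.
rewrite -supM ?rnorm_ge0//; [|exact: rnorm_ball0|exact: opnorm_has_ubound].
by congr sup; apply: eq_imagel => x _; rewrite -rnormZ.
Qed.

Lemma opnorm_eq0 (f : blop) : (opnorm f)%:C = 0 -> f = 0.
Proof.
move=> /complexI f0; apply: val_inj; apply/funext => x /=.
have fb y : rnorm y <= 1 -> f y = 0.
  move=> /(le_opnorm1 f); rewrite f0 => fy0; apply: rnorm_eq0.
  by apply/eqP; rewrite eq_le fy0 rnorm_ge0.
have [x0|x0] := eqVneq (rnorm x) 0.
  by apply: fb; rewrite x0.
have : f ((rnorm x)^-1%:C *: x + 0) = 0.
  apply: fb; rewrite addr0 rnormZ.
  have -> : rnorm ((rnorm x)^-1)%:C = (rnorm x)^-1 :> R.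
    by apply: complexI; rewrite -rnormE ger0_norm// ler0c invr_ge0 rnorm_ge0.
  by rewrite mulVf.
rewrite blop_linear [f 0]fb ?rnorm0// addr0 => /eqP.
rewrite scaler_eq0 => /orP[|/eqP//].
by rewrite (_ : 0 = 0%:C)// => /eqP/complexI/eqP; rewrite invr_eq0 (negbTE x0).
Qed.

HB.instance Definition _ := Lmodule_isNormed.Build R[i] blop opnormD opnormZ opnorm_eq0.

End bounded_linear_operators.

Definition dual (R : realType) (V : normedModType R[i]) := blop V R[i]^o.

(* The sets under sup below are bounded by the operator norm, so sup (which is
   0 by convention on empty or unbounded sets) is a genuine supremum here as
   soon as X is nontrivial. *)
Section numerical_radius.
Context {R : realType} {X : normedModType R[i]}.

Definition numPi : set (X * dual X) :=
  [set p : X * dual X | [/\ `|p.1| = 1, `|p.2| = 1 & p.2 p.1 = 1]].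

Definition numerical_radius (T : blop X X) : R :=
  sup [set rnorm (p.2 (T p.1)) | p in numPi].

Definition attains_numerical_radius (T : blop X X) : Prop :=
  exists2 p, numPi p & rnorm (p.2 (T p.1)) = numerical_radius T.

End numerical_radius.

Section ell1.
Context (R : realType).

Definition ell1_pred : {pred nat -> R[i]} := fun x : nat -> R[i] =>
  `[< cvgn (series (fun n => rnorm (x n))) >].

Record ell1 := Ell1 { ell1_val :> nat -> R[i]; ell1_valP : ell1_val \in ell1_pred }.

HB.instance Definition _ := [isSub for ell1_val].
HB.instance Definition _ := gen_eqMixin ell1.
HB.instance Definition _ := gen_choiceMixin ell1.

Lemma ell1P (x : nat -> R[i]) :
  x \in ell1_pred <-> cvgn (series (fun n => rnorm (x n))).
Proof. by split => [/asboolP|?]//; exact/asboolP. Qed.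

Lemma ell1_submod_closed : submod_closed ell1_pred.
Proof.
split => [|a x y /ell1P cx /ell1P cy].
  apply/ell1P; under eq_fun do rewrite /= rnorm0.
  apply: (@cvgP _ _ (0 : R)); rewrite [X in X @ _](_ : _ = cst 0).
    exact: cvg_cst.
  by apply/funext => n; rewrite /series /= big1.
have cax := @is_cvg_seriesZ _ _ (rnorm a) cx.
apply/ell1P; apply: series_le_cvg (is_cvg_seriesD cax cy).
- by move=> n; exact: rnorm_ge0.
- move=> n; rewrite !fctE/=; apply: addr_ge0; last exact: rnorm_ge0.
  by apply: mulr_ge0; exact: rnorm_ge0.
- move=> n; rewrite !fctE/=; apply: le_trans (rnormD _ _) _.
  by rewrite lerD2r [leLHS]rnormM.
Qed.

HB.instance Definition _ :=
  GRing.isSubmodClosed.Build _ _ ell1_pred ell1_submod_closed.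
HB.instance Definition _ := [SubChoice_isSubLmodule of ell1 by <:].

Definition ell1_norm (x : ell1) : R := limn (series (fun n => rnorm (x n))).

Lemma ell1_cvg (x : ell1) : cvgn (series (fun n => rnorm (x n))).
Proof. by apply/ell1P; exact: valP. Qed.

Lemma ell1_normD (x y : ell1) :
  (ell1_norm (x + y))%:C <= (ell1_norm x)%:C + (ell1_norm y)%:C.
Proof.
rewrite -rmorphD lecR /ell1_norm -lim_seriesD; try exact: ell1_cvg.
apply: lim_series_le; first exact: ell1_cvg.
  by apply: is_cvg_seriesD; exact: ell1_cvg.
by move=> n; rewrite fctE; exact: rnormD.
Qed.

Lemma ell1_normZ (a : R[i]) (x : ell1) :
  (ell1_norm (a *: x))%:C = `|a| * (ell1_norm x)%:C.
Proof.
rewrite rnormE -rmorphM; congr (_ %:C).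
rewrite /ell1_norm -[RHS](lim_seriesZ (rnorm a) (@ell1_cvg x)).
congr (limn (series _)); apply/funext => n; exact: rnormM.
Qed.

Lemma le_ell1_norm (x : ell1) n : rnorm (x n) <= ell1_norm x.
Proof.
have nd : nondecreasing_seq (series (fun n => rnorm (x n))).
  by apply: nondecreasing_series => k _ _; exact: rnorm_ge0.
apply: le_trans (nondecreasing_cvgn_le nd (@ell1_cvg x) n.+1).
rewrite /series /= big_nat_recr//= lerDr sumr_ge0// => i _.
exact: rnorm_ge0.
Qed.

Lemma ell1_norm_eq0 (x : ell1) : (ell1_norm x)%:C = 0 -> x = 0.
Proof.
move=> /complexI x0; apply: val_inj; apply/funext => n /=.
apply: rnorm_eq0; apply/eqP; rewrite eq_le rnorm_ge0 andbT.
by have := le_ell1_norm x n; rewrite x0.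
Qed.

HB.instance Definition _ :=
  Lmodule_isNormed.Build R[i] ell1 ell1_normD ell1_normZ ell1_norm_eq0.

End ell1.

Section c0.
Context (R : realType).

Definition c0_pred : {pred nat -> R[i]} := fun x : nat -> R[i] =>
  `[< (x n : R[i]^o) @[n --> \oo] --> (0 : R[i]^o) >].

Record c0 := C0 { c0_val :> nat -> R[i]; c0_valP : c0_val \in c0_pred }.

HB.instance Definition _ := [isSub for c0_val].
HB.instance Definition _ := gen_eqMixin c0.
HB.instance Definition _ := gen_choiceMixin c0.

Lemma c0P (x : nat -> R[i]) :
  x \in c0_pred <-> (x n : R[i]^o) @[n --> \oo] --> (0 : R[i]^o).
Proof. by split => [/asboolP|?]//; exact/asboolP. Qed.

Lemma c0_submod_closed : submod_closed c0_pred.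
Proof.
split => [|a x y /c0P cx /c0P cy]; apply/c0P; first exact: cvg_cst.
have : (a *: (x n : R[i]^o) + y n) @[n --> \oo] --> (a *: 0 + 0 : R[i]^o).
  by apply: cvgD cy; exact: cvgZl_tmp.
by rewrite scaler0 addr0.
Qed.

HB.instance Definition _ :=
  GRing.isSubmodClosed.Build _ _ c0_pred c0_submod_closed.
HB.instance Definition _ := [SubChoice_isSubLmodule of c0 by <:].

Definition c0_norm (x : c0) : R := sup (range (fun n => rnorm (x n))).

Lemma c0_has_ubound (x : c0) : has_ubound (range (fun n => rnorm (x n))).
Proof.
have /c0P := valP x => /cvgr0Pnorm_lt /(_ 1 ltr01)[N _ xN].
exists (1 + \sum_(k < N) rnorm (x k)) => _ [n _ <-].
have s0 (P : pred 'I_N) : 0 <= \sum_(k < N | P k) rnorm (x k).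
  by apply: sumr_ge0 => i _; exact: rnorm_ge0.
have [Nn|nN] := leqP N n.
  have := xN n Nn; rewrite /= -[`|_|]/(`|x n|) rnormE ltcR => /ltW x1.
  by rewrite (le_trans x1)// lerDl.
rewrite (bigD1 (Ordinal nN))//= addrCA lerDl; apply: addr_ge0; last exact: s0.
exact: ler01.
Qed.

Lemma le_c0_norm (x : c0) n : rnorm (x n) <= c0_norm x.
Proof. by apply: ub_le_sup; [exact: c0_has_ubound|exists n]. Qed.

Lemma c0_normD (x y : c0) :
  (c0_norm (x + y))%:C <= (c0_norm x)%:C + (c0_norm y)%:C.
Proof.
rewrite -rmorphD lecR; apply: ge_sup; first by exists (rnorm ((x + y) 0%N)), 0%N.
move=> _ [n _ <-]; apply: le_trans (rnormD _ _) _.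
by rewrite lerD// le_c0_norm.
Qed.

Lemma c0_normZ (a : R[i]) (x : c0) :
  (c0_norm (a *: x))%:C = `|a| * (c0_norm x)%:C.
Proof.
rewrite rnormE -rmorphM; congr (_ %:C); rewrite /c0_norm.
rewrite -[RHS]supM ?rnorm_ge0//; last exact: c0_has_ubound.
by congr sup; apply: eq_imagel => n _; exact: rnormM.
Qed.

Lemma c0_norm_eq0 (x : c0) : (c0_norm x)%:C = 0 -> x = 0.
Proof.
move=> /complexI x0; apply: val_inj; apply/funext => n /=.
apply: rnorm_eq0; apply/eqP; rewrite eq_le rnorm_ge0 andbT.
by have := le_c0_norm x n; rewrite x0.
Qed.

HB.instance Definition _ :=
  Lmodule_isNormed.Build R[i] c0 c0_normD c0_normZ c0_norm_eq0.

End c0.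

(* The library's norm on a product of normed modules is the maximum of the two norms. *)
Definition ell1_oplus_c0 (R : realType) : normedModType R[i] :=
  (ell1 R * c0 R)%type.

(* Main.v *)
(* Write [T p = (T1 p, T2 p)] with [T1] valued in [ell1] and [T2] in [c0].
   Norming [T1 (e_n, y)] by signs equal to [1] at [n] gives a state at
   [(e_n, y)], and likewise a coordinate functional of [c0] gives a state at any
   [(x, y)] with [|y_m| = 1]; so it suffices to perturb [T], without touching the
   other component, so that the larger of [|T1|] and [|T2|] is attained at such a
   point.  Let [F] be [T1], or a nearly optimal coordinate of [T2].  Its target
   is complex uniformly convex ([complex_convex] below), so near a maximizer of
   finite support the tail of [y] can contribute little: [F] restricted to [c0]
   is close to [F] composed with a truncation.  Adding to this truncated operator
   a small rank-one term that depends on [x_n] only makes [e_n] beat all the other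
   basis vectors of [ell1], and the maximum over [y] is then a maximum over a
   finite-dimensional polydisc, attained by compactness. *)

Require Import Defs.
From HB Require Import structures.
From mathcomp Require Import all_boot all_order all_algebra.
From mathcomp Require Import all_classical all_reals all_analysis.
From mathcomp Require Import complex.
From mathcomp Require Import lra.

Set Implicit Arguments.
Unset Strict Implicit.
Unset Printing Implicit Defensive.

Import Order.TTheory GRing.Theory Num.Theory.
Import numFieldNormedType.Exports.

Local Open Scope classical_set_scope.
Local Open Scope ring_scope.
Local Open Scope complex_scope.

(** * Modulus and phase of complex numbers, and complex uniform convexity *)

Section complex_norm.
Context {R : realType}.
Implicit Types (V : normedZmodType R[i]) (z w u : R[i]) (r : R).

Lemma rnormN V (v : V) : rnorm (- v) = rnorm v.
Proof. by rewrite /rnorm normrN. Qed.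

Lemma rnormB V (v w : V) : rnorm (v - w) <= rnorm v + rnorm w.
Proof. by rewrite -(rnormN w); exact: rnormD. Qed.

Lemma rnorm_distD V (v w : V) : rnorm v <= rnorm (v - w) + rnorm w.
Proof. by rewrite -{1}(subrK w v); exact: rnormD. Qed.

Lemma rnorm_sum V (I : Type) (s : seq I) (P : pred I) (F : I -> V) :
  rnorm (\sum_(i <- s | P i) F i) <= \sum_(i <- s | P i) rnorm (F i).
Proof.
elim/big_rec2: _ => [|i a v _ h]; first by rewrite rnorm0.
by apply: le_trans (rnormD _ _) _; rewrite lerD2l.
Qed.

Lemma rnorm_complexE z : rnorm z = Num.sqrt (complex.Re z ^+ 2 + complex.Im z ^+ 2).
Proof. by rewrite /rnorm normc_def. Qed.

Lemma rnorm_real r : rnorm r%:C = `|r|.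
Proof. by rewrite rnorm_complexE/= expr0n addr0 sqrtr_sqr. Qed.

Lemma rnorm_ge0_real r : 0 <= r -> rnorm r%:C = r.
Proof. by move=> r0; rewrite rnorm_real ger0_norm. Qed.

Lemma rnorm1 : rnorm (1 : R[i]) = 1.
Proof. by rewrite rnorm_real normr1. Qed.

Lemma rnorm_conjc z : rnorm z^* = rnorm z.
Proof. by rewrite /rnorm normcJ. Qed.

Lemma Re_le_rnorm z : complex.Re z <= rnorm z.
Proof.
rewrite rnorm_complexE; apply: le_trans (ler_norm _) _.
by rewrite -sqrtr_sqr ler_wsqrtr// lerDl sqr_ge0.
Qed.

Lemma normr_Re_le z : `|complex.Re z| <= rnorm z.
Proof. by rewrite rnorm_complexE -sqrtr_sqr ler_wsqrtr// lerDl sqr_ge0. Qed.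

Lemma normr_Im_le z : `|complex.Im z| <= rnorm z.
Proof. by rewrite rnorm_complexE -sqrtr_sqr ler_wsqrtr// lerDr sqr_ge0. Qed.

Lemma rnorm_le_ReIm z : rnorm z <= `|complex.Re z| + `|complex.Im z|.
Proof.
rewrite {1}[z]complexE; apply: le_trans (rnormD _ _) _.
rewrite rnormM !rnorm_real lerD2l rnorm_complexE/=.
by rewrite expr0n add0r expr1n sqrtr1 mul1r.
Qed.

Lemma mulJc_rnorm z : z^* * z = (rnorm z ^+ 2)%:C.
Proof. by rewrite mulrC -sqr_normc rnormE rmorphXn. Qed.

(** The value 1 at 0 keeps [phase z] unimodular for every [z]. *)
Definition phase z : R[i] := if z == 0 then 1 else z / (rnorm z)%:C.

Lemma phaseE z : z = (rnorm z)%:C * phase z.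
Proof.
rewrite /phase; case: eqVneq => [->|z0]; first by rewrite rnorm0 mul0r.
by rewrite mulrC divfK// -rnormE normr_eq0.
Qed.

Lemma rnorm_phase z : rnorm (phase z) = 1.
Proof.
rewrite /phase; case: eqVneq => [_|z0]; first exact: rnorm1.
have nz0 : rnorm z != 0 by apply: contra_neq z0 => /rnorm_eq0.
by rewrite -fmorphV rnormM rnorm_real ger0_norm ?divff// invr_ge0 rnorm_ge0.
Qed.

Lemma conj_phaseM z : (phase z)^* * phase z = 1.
Proof. by rewrite mulJc_rnorm rnorm_phase expr1n. Qed.

Lemma conj_phase_mul z : (phase z)^* * z = (rnorm z)%:C.
Proof. by rewrite {2}[z]phaseE mulrCA conj_phaseM mulr1. Qed.

(* The vector [(1 - d ^ 2, d)] has Euclidean norm at most 1: Cauchy-Schwarz. *)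
Lemma rnorm_ge_lin d z : 0 <= d <= 1 ->
  (1 - d ^+ 2) * complex.Re z + d * `|complex.Im z| <= rnorm z.
Proof.
move=> d01; rewrite rnorm_complexE -(real_normK (num_real (complex.Im z))).
set a := complex.Re z; set b := `|complex.Im z|.
apply: le_trans (ler_norm _) _; rewrite -sqrtr_sqr ler_wsqrtr//.
have := sqr_ge0 (d * a - (1 - d ^+ 2) * b).
have : 0 <= (a ^+ 2 + b ^+ 2) * (d ^+ 2 * (1 - d ^+ 2)).
  apply: mulr_ge0; first by rewrite addr_ge0 ?sqr_ge0.
  by rewrite mulr_ge0 ?sqr_ge0// subr_ge0 expr_le1//; case/andP: d01.
nra.
Qed.

(** Apply [rnorm_ge_lin] to each of the four terms. The real parts add up to [4 * r], while the
    absolute imaginary parts add up to twice [|Re w| + |Im w|], which is at least [2 * rnorm w]. *)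
Lemma complex_convex_real d r w : 0 <= d <= 1 ->
  4 * ((1 - d ^+ 2) * r + d / 2 * rnorm w) <=
  rnorm (r%:C + w) + rnorm (r%:C - w) +
  (rnorm (r%:C + 'i * w) + rnorm (r%:C - 'i * w)).
Proof.
move=> d01.
have h1 := rnorm_ge_lin (r%:C + w) d01.
have h2 := rnorm_ge_lin (r%:C - w) d01.
have h3 := rnorm_ge_lin (r%:C + 'i * w) d01.
have h4 := rnorm_ge_lin (r%:C - 'i * w) d01.
have := rnorm_le_ReIm w; case/andP: d01 => d0 d1 hw.
have {}hw : d * rnorm w <= d * `|complex.Re w| + d * `|complex.Im w|.
  by rewrite -mulrDr ler_wpM2l.
move: h1 h2 h3 h4.
case: w hw => [s t] /= hw; simpc => /=; rewrite !normrN; lra.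
Qed.

(** Multiplying everything by the conjugate phase of [z] makes [z] real and nonnegative without
    changing any modulus. *)
Lemma complex_convexC d z w : 0 <= d <= 1 ->
  4 * ((1 - d ^+ 2) * rnorm z + d / 2 * rnorm w) <=
  rnorm (z + w) + rnorm (z - w) + (rnorm (z + 'i * w) + rnorm (z - 'i * w)).
Proof.
move=> d01; have := @complex_convex_real d (rnorm z) ((phase z)^* * w) d01.
have e x : rnorm ((phase z)^* * x) = rnorm x.
  by rewrite rnormM rnorm_conjc rnorm_phase mul1r.
by rewrite -conj_phase_mul mulrCA -!mulrDr -!mulrBr !e.
Qed.

End complex_norm.

(** A quantitative complex uniform convexity: the mean of the norm over [v + u w], with [u] running
    over the fourth roots of unity, exceeds [rnorm v] by an amount controlled by [w]. The free
    parameter [d] linearizes the usual quadratic gain; for fixed [d] the bound is linear in the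
    norms, hence can be summed over coordinates. *)
Definition complex_convex (R : realType) (E : normedModType R[i]) :=
  forall (d : R) (v w : E), 0 <= d <= 1 ->
  4 * ((1 - d ^+ 2) * rnorm v + d / 2 * rnorm w) <=
  rnorm (v + w) + rnorm (v - w) + (rnorm (v + 'i *: w) + rnorm (v - 'i *: w)).

Section complex_convexity.
Context {R : realType}.

Lemma complex_convex_scalar : complex_convex (R[i]^o : normedModType R[i]).
Proof. by move=> d v w; exact: complex_convexC. Qed.

(** The scalar inequality holds in every coordinate with the same [d], and both sides are sums of
    coordinate terms. *)
Lemma complex_convex_ell1 : complex_convex (ell1 R).
Proof.
move=> d v w d01; have c := @ell1_cvg R.
have cvw z := is_cvg_seriesD (c (v + z)) (c (v - z)).
have cl : cvgn (series ((1 - d ^+ 2) *: (fun n => rnorm (v n)) +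
                        (d / 2) *: (fun n => rnorm (w n)))).
  by apply: is_cvg_seriesD; apply: is_cvg_seriesZ; exact: c.
rewrite -[rnorm v]/(ell1_norm v) -[rnorm w]/(ell1_norm w).
rewrite -[rnorm (v + w)]/(ell1_norm (v + w)) -[rnorm (v - w)]/(ell1_norm (v - w)).
rewrite -[rnorm (v + 'i *: w)]/(ell1_norm (v + 'i *: w)).
rewrite -[rnorm (v - 'i *: w)]/(ell1_norm (v - 'i *: w)).
have -> : 4 * ((1 - d ^+ 2) * ell1_norm v + d / 2 * ell1_norm w) =
  limn (series (4 *: ((1 - d ^+ 2) *: (fun n => rnorm (v n)) +
                        (d / 2) *: (fun n => rnorm (w n))))).
  rewrite (lim_seriesZ _ cl) lim_seriesD; try by apply: is_cvg_seriesZ; exact: c.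
  by rewrite (lim_seriesZ _ (c v)) (lim_seriesZ _ (c w)).
rewrite /ell1_norm -!lim_seriesD//.
apply: lim_series_le.
- exact: is_cvg_seriesZ.
- exact: is_cvg_seriesD.
- by move=> n; rewrite !fctE; exact: complex_convexC.
Qed.

End complex_convexity.

(** * Bounded operators: operator norm, composition, and maps of a product *)

Section bounded_operators.
Context {R : realType}.

HB.instance Definition _ (V W : normedModType R[i]) (f : blop V W) :=
  GRing.isLinear.Build R[i] V W *:%R (blop_val f) (blop_linear f).

Lemma mk_blop_subproof (V W : normedModType R[i]) (f : V -> W) (M : R) :
  linear f -> (forall x, rnorm (f x) <= M * rnorm x) -> f \in @bounded_linear R V W.
Proof. by move=> lf bf; apply/bounded_linearP; split=> //; exists M. Qed.

Definition mk_blop (V W : normedModType R[i]) (f : V -> W) (M : R)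
  (lf : linear f) (bf : forall x, rnorm (f x) <= M * rnorm x) : blop V W :=
  Blop (mk_blop_subproof lf bf).

Section opnorm.
Context {V W : normedModType R[i]}.
Implicit Types f : blop V W.

Lemma rnorm_opnorm f : rnorm f = opnorm f. Proof. by []. Qed.

Lemma opnorm_ge0 f : 0 <= opnorm f.
Proof. by rewrite -rnorm_opnorm rnorm_ge0. Qed.

Lemma le_opnorm f x : rnorm (f x) <= opnorm f * rnorm x.
Proof.
have [x0|x0] := eqVneq (rnorm x) 0.
  by rewrite (rnorm_eq0 x0) linear0 !rnorm0 mulr0.
have xp : 0 < rnorm x by rewrite lt_neqAle eq_sym x0 rnorm_ge0.
rewrite -ler_pdivrMr// mulrC -[_^-1]ger0_norm ?invr_ge0 ?rnorm_ge0//.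
rewrite -rnorm_real -rnormZ -linearZ; apply: le_opnorm1.
by rewrite rnormZ rnorm_real ger0_norm ?invr_ge0 ?rnorm_ge0// mulVf.
Qed.

Lemma opnorm_le f M : (forall x, rnorm x <= 1 -> rnorm (f x) <= M) ->
  opnorm f <= M.
Proof.
move=> fM; apply: ge_sup => [|_ [x x1 <-]]; last exact: fM.
by exists (rnorm (f 0)), 0 => //=; rewrite rnorm0.
Qed.

Lemma opnorm_gt f M : M < opnorm f -> exists2 x, rnorm x <= 1 & M < rnorm (f x).
Proof.
move=> Mf; apply: contrapT => nx; move: Mf; apply/negP; rewrite -leNgt.
apply: opnorm_le => x x1; rewrite leNgt; apply/negP => fx; apply: nx.
by exists x.
Qed.

End opnorm.

Lemma blop_comp_subproof (U V W : normedModType R[i]) (g : blop V W) (f : blop U V) :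
  linear (g \o f) /\ forall x, rnorm ((g \o f) x) <= opnorm g * opnorm f * rnorm x.
Proof.
split=> [k x y|x]; first by rewrite /= !linearP.
apply: le_trans (le_opnorm _ _) _; rewrite -mulrA ler_wpM2l ?opnorm_ge0//.
exact: le_opnorm.
Qed.

Definition blop_comp (U V W : normedModType R[i]) (g : blop V W) (f : blop U V) :
    blop U W :=
  mk_blop (blop_comp_subproof g f).1 (blop_comp_subproof g f).2.

Lemma blop_ray_subproof (V : normedModType R[i]) (v : V) :
  linear (fun c : R[i]^o => c *: v) /\
  forall c : R[i]^o, rnorm (c *: v) <= rnorm v * rnorm c.
Proof.
by split=> [k x y|x]; [rewrite scalerDl scalerA|rewrite rnormZ mulrC].
Qed.

(** Composed with a functional, this gives the rank-one operators used as perturbations. *)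
Definition blop_ray (V : normedModType R[i]) (v : V) : blop R[i]^o V :=
  mk_blop (blop_ray_subproof v).1 (blop_ray_subproof v).2.

Section product.
Context {V W : normedModType R[i]}.

Lemma rnorm_pair (p : V * W) : rnorm p = Num.max (rnorm p.1) (rnorm p.2).
Proof.
rewrite {1}/rnorm prod_normE !rnormE.
by rewrite maxEle lecR; case: leP.
Qed.

Lemma rnorm_pair_le (p : V * W) M :
  (rnorm p <= M) = (rnorm p.1 <= M) && (rnorm p.2 <= M).
Proof. by rewrite rnorm_pair ge_max. Qed.

Lemma blop_fst_subproof : linear (fst : V * W -> V) /\
  forall p : V * W, rnorm p.1 <= 1 * rnorm p.
Proof. by split=> // p; rewrite mul1r rnorm_pair le_max lexx. Qed.

Lemma blop_snd_subproof : linear (snd : V * W -> W) /\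
  forall p : V * W, rnorm p.2 <= 1 * rnorm p.
Proof. by split=> // p; rewrite mul1r rnorm_pair le_max lexx orbT. Qed.

Lemma blop_inl_subproof : linear (fun v => (v, 0) : V * W) /\
  forall v, rnorm ((v, 0) : V * W) <= 1 * rnorm v.
Proof.
split=> [k x y|x].
  by rewrite -[RHS]/(k *: x + y, k *: 0 + 0) scaler0 addr0.
by rewrite rnorm_pair_le/= mul1r rnorm0 rnorm_ge0 lexx.
Qed.

Lemma blop_inr_subproof : linear (fun w => (0, w) : V * W) /\
  forall w, rnorm ((0, w) : V * W) <= 1 * rnorm w.
Proof.
split=> [k x y|x].
  by rewrite -[RHS]/(k *: 0 + 0, k *: x + y) scaler0 addr0.
by rewrite rnorm_pair_le/= mul1r rnorm0 rnorm_ge0 lexx.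
Qed.

Definition blop_fst : blop (V * W)%type V :=
  mk_blop blop_fst_subproof.1 blop_fst_subproof.2.
Definition blop_snd : blop (V * W)%type W :=
  mk_blop blop_snd_subproof.1 blop_snd_subproof.2.
Definition blop_inl : blop V (V * W)%type :=
  mk_blop blop_inl_subproof.1 blop_inl_subproof.2.
Definition blop_inr : blop W (V * W)%type :=
  mk_blop blop_inr_subproof.1 blop_inr_subproof.2.

End product.

End bounded_operators.

(** * Unit vectors, coordinates and truncations in [ell1] and [c0] *)

Section sequence_spaces.
Context {R : realType}.

Lemma lim_series_finsupp (u : R^nat) N : (forall k, (N <= k)%N -> u k = 0) ->
  series u @ \oo --> \sum_(k < N) u k.
Proof.
move=> u0; apply: cvg_near_cst; exists N => //= n /= Nn.
rewrite /series /= (big_cat_nat _ Nn)//= big_mkord.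
rewrite [X in _ + X]big_nat [X in _ + X]big1 ?addr0//.
by move=> i /andP[Ni _]; exact: u0.
Qed.

Lemma e1_subproof n : (fun k => (k == n)%:R : R[i]) \in @ell1_pred R.
Proof.
apply/ell1P; apply: cvgP; apply: (@lim_series_finsupp _ n.+1) => k nk.
by rewrite gtn_eqF// rnorm0.
Qed.

Definition e1 n : ell1 R := Ell1 (e1_subproof n).

Lemma e1E n k : e1 n k = (k == n)%:R. Proof. by []. Qed.

Lemma ec_subproof n : (fun k => (k == n)%:R : R[i]) \in @c0_pred R.
Proof.
apply/c0P; apply: cvg_near_cst; exists n.+1 => //= k nk.
by rewrite gtn_eqF.
Qed.

Definition ec n : c0 R := C0 (ec_subproof n).

Lemma ecE n k : ec n k = (k == n)%:R. Proof. by []. Qed.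

Lemma ell1_coord_subproof n : linear (fun x : ell1 R => x n : R[i]^o) /\
  forall x : ell1 R, rnorm (x n : R[i]^o) <= 1 * rnorm x.
Proof. by split=> // x; rewrite mul1r; exact: le_ell1_norm. Qed.

Definition ell1_coord n : blop (ell1 R) R[i]^o :=
  mk_blop (ell1_coord_subproof n).1 (ell1_coord_subproof n).2.

Lemma c0_coord_subproof n : linear (fun x : c0 R => x n : R[i]^o) /\
  forall x : c0 R, rnorm (x n : R[i]^o) <= 1 * rnorm x.
Proof. by split=> // x; rewrite mul1r; exact: le_c0_norm. Qed.

Definition c0_coord n : blop (c0 R) R[i]^o :=
  mk_blop (c0_coord_subproof n).1 (c0_coord_subproof n).2.

Lemma c0_norm_le (y : c0 R) M : (rnorm y <= M) <-> (forall n, rnorm (y n) <= M).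
Proof.
split=> [yM n|yM]; first exact: le_trans (le_c0_norm y n) yM.
apply: ge_sup => [|_ [n _ <-]]; last exact: yM.
by exists (rnorm (y 0%N)), 0%N.
Qed.

Lemma rnorm_e1 n : rnorm (e1 n) = 1.
Proof.
rewrite -[LHS]/(ell1_norm (e1 n)) /ell1_norm.
have /cvg_lim -> // : series (fun k => rnorm (e1 n k)) @ \oo -->
    \sum_(k < n.+1) rnorm (e1 n k).
  by apply: lim_series_finsupp => k nk; rewrite e1E gtn_eqF// rnorm0.
rewrite big_ord_recr/= eqxx rnorm1 big1 ?add0r// => i _.
by rewrite ltn_eqF// rnorm0.
Qed.

Lemma rnorm_ec n : rnorm (ec n) <= 1.
Proof.
by apply/c0_norm_le => k; rewrite ecE; case: eqP; rewrite ?rnorm1 ?rnorm0.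
Qed.

Definition trunc_l1 N (x : ell1 R) : ell1 R := \sum_(k < N) x k *: e1 k.
Definition trunc_c0 N (y : c0 R) : c0 R := \sum_(k < N) y k *: ec k.

Lemma sum_delta N (a : nat -> R[i]) (j : nat) :
  \sum_(k < N) a k * (j == k :> nat)%:R = if (j < N)%N then a j else 0.
Proof.
case: ifP => jN; last first.
  by rewrite big1// => i _; rewrite gtn_eqF ?mulr0// (leq_trans (ltn_ord i))// leqNgt jN.
rewrite (bigD1 (Ordinal jN))//= eqxx mulr1 big1 ?addr0// => i ij.
by rewrite [j == i]eq_sym (negbTE (_ : nat_of_ord i != j)) ?mulr0.
Qed.

Lemma trunc_l1E N x j : trunc_l1 N x j = if (j < N)%N then x j else 0.
Proof.
rewrite -[LHS]/(ell1_coord j (trunc_l1 N x)) linear_sum -sum_delta.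
by apply: eq_bigr => i _; rewrite linearZ.
Qed.

Lemma trunc_c0E N y j : trunc_c0 N y j = if (j < N)%N then y j else 0.
Proof.
rewrite -[LHS]/(c0_coord j (trunc_c0 N y)) linear_sum -sum_delta.
by apply: eq_bigr => i _; rewrite linearZ.
Qed.

Lemma trunc_l1_cvg (x : ell1 R) (e : R) : 0 < e ->
  exists N, rnorm (x - trunc_l1 N x) <= e.
Proof.
move=> e0; have c := @ell1_cvg R x.
have /cvgrPdist_le /(_ e e0)[N _ /(_ N (leqnn N)) h] :
  series (fun n => rnorm (x n)) @ \oo --> ell1_norm x by [].
exists N; rewrite -[leLHS]/(ell1_norm _); apply: le_trans h.
apply: le_trans (ler_norm _); rewrite /ell1_norm.
(* The partial sum is itself written as the limit of a series, so that the tail can be compared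
   termwise. *)
have fs : series (fun k => if (k < N)%N then rnorm (x k) else 0) @ \oo -->
    \sum_(k < N) (if (k < N)%N then rnorm (x k) else 0).
  by apply: lim_series_finsupp => k; rewrite leqNgt => /negbTE ->.
rewrite (_ : series _ N = limn (series
    (fun k => if (k < N)%N then rnorm (x k) else 0))); last first.
  rewrite (cvg_lim _ fs)// /series/= big_mkord.
  by apply: eq_bigr => i _; rewrite ltn_ord.
rewrite -lim_seriesB//; last exact: cvgP fs.
apply: lim_series_le; [exact: ell1_cvg|exact: is_cvg_seriesB c (cvgP _ fs)|].
move=> n; rewrite !fctE -[(x - _) n]/(x n - trunc_l1 N x n) trunc_l1E.
by case: ifP => _; rewrite ?subrr ?rnorm0 ?subr0.
Qed.

Lemma trunc_c0_cvg (y : c0 R) (e : R) : 0 < e ->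
  exists N, rnorm (y - trunc_c0 N y) <= e.
Proof.
move=> e0; have e0' : 0 < e%:C :> R[i] by rewrite -[0]/(0%:C) ltcR.
have /c0P := c0_valP y => /cvgr0Pnorm_lt /(_ _ e0')[N _ yN].
exists N; apply/c0_norm_le => n.
rewrite -[(y - _) n]/(y n - trunc_c0 N y n) trunc_c0E.
have [nN|Nn] := ltnP n N; first by rewrite subrr rnorm0 ltW.
have := yN n Nn; rewrite /= -[`|_|]/(`|y n|) rnormE ltcR subr0.
exact: ltW.
Qed.

Lemma trunc_c0_linear N : linear (trunc_c0 N).
Proof.
move=> a x y; apply: val_inj; apply/funext => j /=.
rewrite -[RHS]/(a * trunc_c0 N x j + trunc_c0 N y j) !trunc_c0E.
by case: ifP; rewrite // mulr0 addr0.
Qed.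

Lemma rnorm_trunc_c0_le N y : rnorm (trunc_c0 N y) <= 1 * rnorm y.
Proof.
rewrite mul1r; apply/c0_norm_le => n; rewrite trunc_c0E.
by case: ifP; rewrite ?rnorm0 ?rnorm_ge0// => _; exact: le_c0_norm.
Qed.

Definition blop_trunc_c0 N : blop (c0 R) (c0 R) :=
  mk_blop (@trunc_c0_linear N) (@rnorm_trunc_c0_le N).

(** The two summands have disjoint supports, and the sup norm does not add over these. *)
Lemma rnorm_trunc_c0D (N : nat) (y z : c0 R) : rnorm y <= 1 -> rnorm z <= 1 ->
  rnorm (trunc_c0 N y + (z - trunc_c0 N z)) <= 1.
Proof.
move=> /c0_norm_le y1 /c0_norm_le z1; apply/c0_norm_le => n.
rewrite -[(trunc_c0 N y + _) n]/(trunc_c0 N y n + (z n - trunc_c0 N z n)) !trunc_c0E.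
by case: ifP => _; rewrite ?subrr ?addr0// subr0 add0r.
Qed.

End sequence_spaces.

(** * Norm estimates for operators defined on the sum and on [c0] *)

Section operators_into_convex_space.
Context {R : realType} {E : normedModType R[i]}.

(** The unit ball of [ell1] is the closed convex hull of the rotated basis vectors. A rotation of
    [e1 k] is moved to [y] by linearity, which keeps [y] in the ball of [c0]. *)
Lemma rnorm_le_on_basis (S : blop (ell1 R * c0 R)%type E) M :
  (forall n y, rnorm y <= 1 -> rnorm (S (e1 n, y)) <= M) ->
  forall p, rnorm p <= 1 -> rnorm (S p) <= M.
Proof.
move=> SM [x y]; rewrite rnorm_pair_le/= => /andP[x1 y1].
pose A := blop_comp S blop_inl; pose B := blop_comp S blop_inr.
have SE u v : S (u, v) = A u + B v.
  by rewrite /= -linearD; congr (S (_, _)); rewrite ?addr0 ?add0r.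
(* [B y] is half the difference of [S (e1 0, y)] and [S (e1 0, - y)]. *)
have By : rnorm (B y) <= M.
  have h1 := SM 0%N y y1; have h2 := SM 0%N (- y); rewrite rnormN in h2.
  have {}h2 := h2 y1; rewrite !SE linearN in h1 h2.
  have : rnorm (2%:C *: B y) <= rnorm (A (e1 0%N) + B y) + rnorm (A (e1 0%N) - B y).
    rewrite (_ : _ *: _ = A (e1 0%N) + B y - (A (e1 0%N) - B y)); first exact: rnormB.
    by rewrite opprB addrC addrA subrK rmorph_nat scaler_nat mulr2n.
  by rewrite rnormZ rnorm_ge0_real//; lra.
apply/ler_addgt0Pr => e e0.
have O0 : 0 < opnorm S + 1 by rewrite ltr_wpDl// opnorm_ge0.
have [K xK] := @trunc_l1_cvg _ x (e / (opnorm S + 1)) (divr_gt0 e0 O0).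
have -> : S (x, y) = B y + A (trunc_l1 K x) + S (x - trunc_l1 K x, 0).
  rewrite !SE [B 0]linear0 addr0 [A (_ - _)]linearB [LHS]addrC -[RHS]addrA.
  by congr (_ + _); rewrite addrC subrK.
apply: le_trans (rnormD _ _) _; rewrite lerD//; last first.
  apply: le_trans (le_opnorm S _) _; rewrite rnorm_pair/= rnorm0.
  rewrite max_l ?rnorm_ge0//.
  apply: le_trans (ler_wpM2l (opnorm_ge0 _) xK) _.
  rewrite mulrCA ger_pMr// ler_pdivrMr// mul1r lerDl//.
pose l := \sum_(k < K) rnorm (x k).
have l1 : l <= 1.
  apply: le_trans x1; rewrite /l -(big_mkord xpredT (fun k => rnorm (x k))).
  apply: (nondecreasing_cvgn_le _ (@ell1_cvg R x) K).
  by apply: nondecreasing_series => k _ _; exact: rnorm_ge0.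
(* A combination with weights [rnorm (x k)] and [1 - l], where [B y] alone carries the missing mass
   [1 - l]. *)
have -> : B y + A (trunc_l1 K x) =
    \sum_(k < K) (x k *: A (e1 k) + (rnorm (x k))%:C *: B y) + (1 - l)%:C *: B y.
  rewrite big_split/= -scaler_suml -rmorph_sum -/l.
  rewrite -addrA -scalerDl -rmorphD subrKC scale1r.
  rewrite addrC; congr (_ + _).
  rewrite -[LHS]/(A (\sum_(i < K) x i *: e1 i)) linear_sum.
  by apply: eq_bigr => i _; rewrite linearZ.
apply: le_trans (rnormD _ _) _.
rewrite [leRHS](_ : M = \sum_(k < K) (rnorm (x k) * M) + (1 - l) * M); last first.
  by rewrite -mulr_suml -mulrDl subrKC mul1r.
apply: lerD; last first.
  by rewrite rnormZ rnorm_ge0_real ?subr_ge0// ler_wpM2l// subr_ge0.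
apply: le_trans (rnorm_sum _ _ _) _; apply: ler_sum => k _.
rewrite {1}[x k]phaseE -scalerA -scalerDr rnormZ rnorm_ge0_real ?rnorm_ge0//.
rewrite ler_wpM2l ?rnorm_ge0//.
rewrite (_ : _ + _ = phase (x k) *: S (e1 k, (phase (x k))^* *: y)); last first.
  by rewrite SE linearZ scalerDr scalerA mulrC conj_phaseM scale1r.
rewrite rnormZ rnorm_phase mul1r; apply: SM.
by rewrite rnormZ rnorm_conjc rnorm_phase mul1r.
Qed.

(** Take a finitely supported near-maximizer of [G]. Adding to it any unimodular multiple of a tail
    [z] stays in the unit ball, so the four norms in [complex_convex] are at most [opnorm G]; this
    leaves little room for [G z]. *)
Lemma c0_tail_small (G : blop (c0 R) E) (e : R) : complex_convex E -> 0 < e ->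
  exists N, forall y, rnorm y <= 1 -> rnorm (G (y - trunc_c0 N y)) <= e.
Proof.
move=> cE e0; set M := opnorm G; have M0 : 0 <= M := opnorm_ge0 G.
(* Convexity will bound [rnorm (G z)] by [2 * d * (M + 2)], and this [d] makes that at most [e]. The
   near-maximizer is chosen within [d ^+ 2] of the norm and its truncation costs another [d ^+ 2],
   to match the loss in [complex_convex]. *)
pose d := Num.min 1 (e / (2 * (M + 2))).
have M2 : 0 < 2 * (M + 2) by lra.
have d0 : 0 < d by rewrite lt_min ltr01 divr_gt0.
have d1 : d <= 1 by rewrite ge_min lexx.
have dM : 2 * d * (M + 2) <= e.
  have : d <= e / (2 * (M + 2)) by rewrite ge_min lexx orbT.
  by rewrite ler_pdivlMr//; lra.
have dd0 : 0 < d ^+ 2 by rewrite exprn_gt0.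
have [y0 y01 Gy0] : exists2 y, rnorm y <= 1 & M - d ^+ 2 < rnorm (G y).
  by apply: opnorm_gt; rewrite ltrBlDr ltrDl.
have M10 : 0 < M + 1 by lra.
have [N hN] := trunc_c0_cvg y0 (divr_gt0 dd0 M10).
have hG : M - 2 * d ^+ 2 <= rnorm (G (trunc_c0 N y0)).
  have : rnorm (G (y0 - trunc_c0 N y0)) <= d ^+ 2.
    apply: le_trans (le_opnorm _ _) _; apply: le_trans (ler_wpM2l M0 hN) _.
    by rewrite mulrCA ger_pMr// ler_pdivrMr// mul1r lerDl.
  have := rnorm_distD (G y0) (G (trunc_c0 N y0)); rewrite linearB; lra.
exists N => y y1; set z := y - _.
have hu u : rnorm u = 1 -> rnorm (G (trunc_c0 N y0) + u *: G z) <= M.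
  move=> u1; rewrite -linearZ -linearD; apply: le_opnorm1.
  rewrite /z scalerBr (_ : u *: trunc_c0 N y = trunc_c0 N (u *: y)); last first.
    by rewrite -[RHS]/(blop_trunc_c0 N _) linearZ.
  by apply: rnorm_trunc_c0D => //; rewrite rnormZ u1 mul1r.
have i1 : rnorm ('i : R[i]) = 1.
  by rewrite rnorm_complexE/= expr0n add0r expr1n sqrtr1.
have /(cE d (G (trunc_c0 N y0)) (G z)) : 0 <= d <= 1 by rewrite ltW.
have h1 := hu 1 (rnorm1); have h2 := hu (-1); rewrite rnormN rnorm1 in h2.
have h3 := hu 'i i1; have h4 := hu (- 'i); rewrite rnormN i1 in h4.
rewrite scale1r in h1; rewrite scaleN1r in h2; rewrite scaleNr in h4.
have {}h2 := h2 erefl; have {}h4 := h4 erefl => h5.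
have {}h5 : (1 - d ^+ 2) * rnorm (G (trunc_c0 N y0)) + d / 2 * rnorm (G z) <= M.
  lra.
have dd1 : 0 <= 1 - d ^+ 2 by rewrite subr_ge0 expr_le1// ltW.
have := ler_wpM2l dd1 hG => h6.
(* Indeed [M - (1 - d ^+ 2) * (M - 2 * d ^+ 2)] is at most [d ^+ 2 * (M + 2)]. *)
have : d * rnorm (G z) <= d * (2 * d * (M + 2)) by nra.
by rewrite ler_pM2l// => /le_trans; apply.
Qed.

End operators_into_convex_space.

(** * Maximizing the norm of an affine map over a finite-dimensional polydisc *)

Section polydisc.
Context {R : realType}.

Lemma c0_extension N (c : 'I_N -> R[i]) : (forall k, rnorm (c k) <= 1) ->
  exists2 y : c0 R, rnorm y <= 1 & forall k : 'I_N, y k = c k.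
Proof.
move=> c1; have cp : (fun k => oapp c 0 (insub k)) \in @c0_pred R.
  apply/c0P; apply: cvg_near_cst; exists N => //= k Nk.
  by rewrite insubN// -leqNgt.
exists (C0 cp) => [|k]; last by rewrite /= valK.
by apply/c0_norm_le => n /=; case: insubP => [k|] _ //=; rewrite ?rnorm0.
Qed.

Lemma normr_coord_le n (r : 'rV[R]_n) j : `|r 0 j| <= `|r|.
Proof.
rewrite [leRHS]/Num.norm/= mx_normrE.
by apply/bigmax_geP; right => /=; exists (0, j).
Qed.

Lemma polydisc_max (E : normedModType R[i]) N (a : E) (g : 'I_N -> E) :
  exists2 c : 'I_N -> R[i], forall k, rnorm (c k) <= 1 &
  forall z : 'I_N -> R[i], (forall k, rnorm (z k) <= 1) ->
  rnorm (a + \sum_(k < N) z k *: g k) <= rnorm (a + \sum_(k < N) c k *: g k).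
Proof.
(* Complex vectors are encoded as real rows, real parts first and imaginary parts second, so that
   the real extreme value theorem applies. *)
pose cx (r : 'rV[R]_(N + N)) k := r 0 (lshift N k) +i* r 0 (rshift N k).
pose f r := rnorm (a + \sum_(k < N) cx r k *: g k).
pose A := [set r : 'rV[R]_(N + N) |
  forall k, r 0 (lshift N k) ^+ 2 + r 0 (rshift N k) ^+ 2 <= 1].
have AE r : A r <-> forall k, rnorm (cx r k) <= 1.
  have e k : (rnorm (cx r k) <= 1) = (r 0 (lshift N k) ^+ 2 + r 0 (rshift N k) ^+ 2 <= 1).
    by rewrite rnorm_complexE -[X in _ <= X]sqrtr1 ler_sqrt// ler01.
  by split=> h k; have := h k; rewrite e.
have A0 : A !=set0 by exists 0 => k; rewrite !mxE expr0n addr0 ler01.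
have cA : compact A.
  apply: bounded_closed_compact.
    exists 1; split=> // M M1 r Ar /=; apply: le_trans (ltW M1).
    rewrite /Num.norm/= mx_normrE; apply/bigmax_leP; split=> // -[i j] _ /=.
    rewrite (ord1 i); case: (split_ordP j) => k ->.
      by apply: le_trans (normr_Re_le (cx r k)) _; have /AE := Ar; apply.
    by apply: le_trans (normr_Im_le (cx r k)) _; have /AE := Ar; apply.
  rewrite (_ : A = \bigcap_(k in setT) [set r : 'rV[R]_(N + N) |
      r 0 (lshift N k) ^+ 2 + r 0 (rshift N k) ^+ 2 <= 1]); last first.
    by apply/seteqP; split=> [r h k _|r h k]; [exact: h|exact: (h k)].
  apply: closed_bigI => k _.
  apply: (@closed_comp _ _ (fun r : 'rV[R]_(N + N) =>
    r 0 (lshift N k) ^+ 2 + r 0 (rshift N k) ^+ 2) [set x | x <= 1]);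
    last exact: closed_le.
  have csq j (r : 'rV[R]_(N + N)) : (s 0 j ^+ 2) @[s --> r] --> r 0 j ^+ 2.
    apply: (@continuous_comp _ _ _ (fun s : 'rV[R]_(N + N) => s 0 j) (fun x => x ^+ 2)).
      exact: coord_continuous.
    exact: exprn_continuous.
  by move=> r _; exact: cvgD (csq _ r) (csq _ r).
(* A Lipschitz constant of [f]: each complex coordinate moves by at most twice the sup distance of
   the rows. *)
pose L := \sum_(k < N) 2 * rnorm (g k).
have L0 : 0 <= L by apply: sumr_ge0 => k _; rewrite mulr_ge0 ?rnorm_ge0.
have fL r s : f r <= f s + L * `|r - s|.
  rewrite addrC; apply: le_trans (rnorm_distD _ (a + \sum_(k < N) cx s k *: g k)) _.
  rewrite lerD2r opprD addrACA subrr add0r -sumrB.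
  apply: le_trans (rnorm_sum _ _ _) _; rewrite /L mulr_suml; apply: ler_sum => k _.
  rewrite -scalerBl rnormZ mulrAC ler_wpM2r ?rnorm_ge0//.
  apply: le_trans (rnorm_le_ReIm _) _; rewrite /= mulrDl mul1r.
  by apply: lerD; [have := normr_coord_le (r - s) (lshift N k)|
    have := normr_coord_le (r - s) (rshift N k)]; rewrite !mxE.
have cf (r : 'rV[R]_(N + N)) : f s @[s --> r] --> f r.
  have ? : Filter (nbhs r) := nbhs_filter r.
  apply/(@cvgrPdist_le _ _ _ (nbhs r)) => e e0.
  have L1 : 0 < L + 1 by rewrite ltr_wpDl.
  near=> s.
  have rs : `|r - s| <= e / (L + 1).
    by near: s; apply: cvgr_dist_le => //; rewrite divr_gt0.
  have {}rs : L * `|r - s| <= e.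
    apply: le_trans (ler_wpM2l L0 rs) _.
    by rewrite mulrCA ger_pMr// ler_pdivrMr// mul1r lerDl.
  have := fL r s; have := fL s r; rewrite (distrC s r) ler_norml; lra.
have [|r rA rmax] := EVT_max_rV A0 cA (f := f).
  exact: continuous_subspaceT.
rewrite inE in rA; exists (cx r); first exact/AE.
move=> z z1; pose s : 'rV[R]_(N + N) :=
  row_mx (\row_k complex.Re (z k)) (\row_k complex.Im (z k)).
have cs k : cx s k = z k.
  by rewrite /cx row_mxEl row_mxEr !mxE; case: (z k).
have := rmax s; rewrite /f inE; under eq_bigr do rewrite cs.
by apply; apply/AE => k; rewrite cs.
Unshelve. all: by end_near. Qed.

End polydisc.

(** * Perturbing an operator so that its norm is attained at a pair [(e1 n, y)] *)

Section attaining_perturbation.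
Context {R : realType} {E : normedModType R[i]}.

(** The distance [5 * e] is [e] for truncation plus [4 * e] for the rank-one term. The vector [u0]
    supplies a direction for that term when the value to be increased is zero. *)
Lemma attaining_perturbation (F : blop (ell1 R * c0 R)%type E) (u0 : E) (e : R) :
  complex_convex E -> rnorm u0 = 1 -> 0 < e ->
  exists (S : blop (ell1 R * c0 R)%type E) (n : nat) (y : c0 R),
  [/\ opnorm (S - F) <= 5 * e, rnorm y <= 1,
      opnorm F + e <= rnorm (S (e1 n, y)) &
      forall p, rnorm p <= 1 -> rnorm (S p) <= rnorm (S (e1 n, y))].
Proof.
move=> cE u01 e0; pose G := blop_comp F blop_inr.
have [N GN] := c0_tail_small G cE e0.
(* By [rnorm_le_on_basis], pairs with a basis vector as first component already approach the norm of
   [F]. *)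
have [n [y0 [y01 Fy0]]] : exists n y, rnorm y <= 1 /\ opnorm F - e < rnorm (F (e1 n, y)).
  apply: contrapT => h; have : opnorm F - e < opnorm F by rewrite ltrBlDr ltrDl.
  apply/negP; rewrite -leNgt; apply: opnorm_le; apply: rnorm_le_on_basis => n y y1.
  by rewrite leNgt; apply/negP => hy; apply: h; exists n, y.
pose F' := F - blop_comp (G - blop_comp G (blop_trunc_c0 N)) blop_snd.
have F'E x y : F' (x, y) = F (x, trunc_c0 N y).
  rewrite -[LHS]/(F (x, y) - (F (0, y) - F (0, trunc_c0 N y))) -!linearB.
  by rewrite -[LHS]/(F (x - (0 - 0), y - (y - trunc_c0 N y))) !subr0 subKr.
have F'F : opnorm (F' - F) <= e.
  apply: opnorm_le => -[x y]; rewrite rnorm_pair_le/= => /andP[_ /GN].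
  rewrite linearB -rnormN; apply: le_trans.
  rewrite -[X in rnorm X <= _]/(F (x, y) - (G y - G (trunc_c0 N y)) - F (x, y)).
  by rewrite addrAC subrr add0r.
(* Along the direction [u] of [F' (e1 n, y0)], adding a positive multiple of [u] increases the norm
   by the full multiple. *)
have [u u1 uE] : exists2 u, rnorm u = 1 &
    F' (e1 n, y0) = (rnorm (F' (e1 n, y0)))%:C *: u.
  have [v0|v0] := eqVneq (F' (e1 n, y0)) 0.
    by exists u0; rewrite // v0 rnorm0 scale0r.
  have nv0 : rnorm (F' (e1 n, y0)) != 0 by apply: contra_neq v0 => /rnorm_eq0.
  exists ((rnorm (F' (e1 n, y0)))^-1%:C *: F' (e1 n, y0)).
    by rewrite rnormZ rnorm_ge0_real ?invr_ge0 ?rnorm_ge0// mulVf.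
  by rewrite scalerA -rmorphM divff// scale1r.
pose B : blop (ell1 R * c0 R)%type E :=
  blop_comp (blop_ray u) (blop_comp (ell1_coord n) blop_fst).
pose S := F' + (4 * e)%:C *: B.
have SE x y : S (x, y) = F (x, trunc_c0 N y) + (4 * e)%:C *: (x n *: u).
  by rewrite -F'E.
have [c c1 cmax] := polydisc_max (F (e1 n, 0) + (4 * e)%:C *: u)
  (fun k : 'I_N => F (0, ec k)).
have [y1 y11 y1c] := c0_extension c1.
have SnE y : S (e1 n, y) =
    F (e1 n, 0) + (4 * e)%:C *: u + \sum_(k < N) y k *: F (0, ec k).
  rewrite SE e1E eqxx scale1r addrAC; congr (_ + _).
  rewrite -[LHS]/(F (e1 n, trunc_c0 N y)).
  have -> : \sum_(k < N) y k *: F (0, ec k) = G (trunc_c0 N y).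
    by rewrite linear_sum; apply: eq_bigr => k _; rewrite linearZ.
  by rewrite /G/= -linearD; congr (F (_, _)); rewrite ?addr0 ?add0r.
have Smax y : rnorm y <= 1 -> rnorm (S (e1 n, y)) <= rnorm (S (e1 n, y1)).
  move=> /c0_norm_le yy; rewrite !SnE.
  have -> : \sum_(k < N) y1 k *: F (0, ec k) = \sum_(k < N) c k *: F (0, ec k).
    by apply: eq_bigr => k _; rewrite y1c.
  exact: cmax.
(* At [y0], near-maximality and truncation lose at most [e] each, while the rank-one term gains
   [4 * e]. *)
have Sge : opnorm F + e <= rnorm (S (e1 n, y1)).
  apply: le_trans (Smax _ y01).
  have -> : S (e1 n, y0) = (rnorm (F' (e1 n, y0)) + 4 * e)%:C *: u.
    by rewrite SE -F'E {1}uE e1E eqxx scale1r -scalerDl rmorphD.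
  rewrite rnormZ u1 mulr1 rnorm_ge0_real; last by rewrite addr_ge0 ?rnorm_ge0//; lra.
  have := rnorm_distD (F (e1 n, y0)) (F' (e1 n, y0)).
  have : rnorm (F (e1 n, y0) - F' (e1 n, y0)) <= e.
    rewrite -rnormN opprB; apply: le_trans F'F.
    by apply: (le_opnorm1 (F' - F)); rewrite rnorm_pair_le/= rnorm_e1 lexx.
  lra.
exists S, n, y1; split=> //.
- rewrite -rnorm_opnorm /S addrAC; apply: le_trans (rnormD _ _) _.
  have : rnorm ((4 * e)%:C *: B) <= 4 * e.
    rewrite rnormZ rnorm_ge0_real; last by lra.
    rewrite ger_pMr; last by lra.
    apply: opnorm_le => -[x y]; rewrite rnorm_pair_le/= => /andP[x1 _].
    by rewrite rnormZ u1 mulr1; apply: le_trans x1; exact: le_ell1_norm.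
  by move: F'F; rewrite -rnorm_opnorm; lra.
(* For [m] different from [n] the rank-one term vanishes at [e1 m], so the value is at most
   [opnorm F]. *)
- apply: rnorm_le_on_basis => m y yy; have [->|mn] := eqVneq m n; first exact: Smax.
  rewrite SE e1E eq_sym (negbTE mn) scale0r scaler0 addr0.
  apply: le_trans (le_opnorm1 _ _) _.
    rewrite rnorm_pair_le/= rnorm_e1 lexx/=.
    by apply: le_trans (rnorm_trunc_c0_le _ _) _; rewrite mul1r.
  by apply: le_trans Sge; rewrite lerDl ltW.
Qed.

End attaining_perturbation.

(** * Norming functionals on [ell1]: summation composed with a multiplier *)

Section norming_functional.
Context {R : realType}.
Implicit Types x v : ell1 R.

Let re_series x : R^nat := fun k => complex.Re (x k).
Let im_series x : R^nat := fun k => complex.Im (x k).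

Lemma is_cvg_re_series x : cvgn (series (re_series x)).
Proof.
apply: normed_cvg; apply: series_le_cvg (@ell1_cvg R x) => k //=.
  exact: rnorm_ge0.
exact: normr_Re_le.
Qed.

Lemma is_cvg_im_series x : cvgn (series (im_series x)).
Proof.
apply: normed_cvg; apply: series_le_cvg (@ell1_cvg R x) => k //=.
  exact: rnorm_ge0.
exact: normr_Im_le.
Qed.

(** Real and imaginary parts are summed separately, so that results on real series apply. *)
Definition ell1_sum x : R[i]^o :=
  limn (series (re_series x)) +i* limn (series (im_series x)).

Lemma ell1_sum_linear : linear ell1_sum.
Proof.
move=> a x y; rewrite /ell1_sum.
have -> : re_series (a *: x + y) =
    complex.Re a *: re_series x + (- complex.Im a) *: im_series x + re_series y.
  apply/funext => k; rewrite !fctE /re_series /im_series.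
  rewrite -[(a *: x + y) k]/(a * x k + y k).
  by case: a (x k) (y k) => [a b] [c d] [f g]; rewrite /= scaleNr.
have -> : im_series (a *: x + y) =
    complex.Re a *: im_series x + complex.Im a *: re_series x + im_series y.
  apply/funext => k; rewrite !fctE /re_series /im_series.
  rewrite -[(a *: x + y) k]/(a * x k + y k).
  by case: a (x k) (y k) => [a b] [c d] [f g].
have lim3 (s t : R) (u v w : R^nat) : cvgn (series u) -> cvgn (series v) ->
    cvgn (series w) -> limn (series (s *: u + t *: v + w)) =
    s * limn (series u) + t * limn (series v) + limn (series w).
  move=> cu cv cw.
  have csu := @is_cvg_seriesZ _ _ s cu; have ctv := @is_cvg_seriesZ _ _ t cv.
  rewrite (lim_seriesD (is_cvg_seriesD csu ctv) cw) (lim_seriesD csu ctv).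
  by rewrite (lim_seriesZ _ cu) (lim_seriesZ _ cv).
have cre := is_cvg_re_series; have cim := is_cvg_im_series.
rewrite (lim3 _ _ _ _ _ (cre x) (cim x) (cre y)).
rewrite (lim3 _ _ _ _ _ (cim x) (cre x) (cim y)).
apply/eqP; rewrite eq_complex; case: a => a b /=.
by rewrite mulNr !eqxx.
Qed.

(** Rotate [x] so that its sum is real and nonnegative, then compare real parts with moduli
    termwise. *)
Lemma rnorm_ell1_sum x : rnorm (ell1_sum x) <= 1 * rnorm x.
Proof.
rewrite mul1r; set u := (phase (ell1_sum x))^*.
have u1 : rnorm u = 1 by rewrite rnorm_conjc rnorm_phase.
(* The added [0] gives the argument the shape required by [ell1_sum_linear]. *)
have -> : rnorm (ell1_sum x) = complex.Re (ell1_sum (u *: x + 0)).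
  rewrite ell1_sum_linear.
  rewrite (_ : ell1_sum 0 = 0) ?addr0; last first.
    have := ell1_sum_linear (-1) 0 0.
    by rewrite scaleN1r oppr0 addr0 scaleN1r addNr.
  by rewrite -[_ *: _]/(u * _) conj_phase_mul.
have -> : rnorm x = rnorm (u *: x + 0) by rewrite addr0 rnormZ u1 mul1r.
apply: lim_series_le; [exact: is_cvg_re_series|exact: ell1_cvg|].
by move=> k; exact: Re_le_rnorm.
Qed.

Definition blop_ell1_sum : blop (ell1 R) R[i]^o :=
  mk_blop ell1_sum_linear rnorm_ell1_sum.

Lemma ell1_sum_ge0 x : (forall k, x k = (rnorm (x k))%:C) ->
  ell1_sum x = (rnorm x)%:C.
Proof.
move=> x0; rewrite /ell1_sum (_ : im_series x = cst 0); last first.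
  by apply/funext => k; rewrite /im_series x0.
rewrite (_ : re_series x = fun k => rnorm (x k)); last first.
  by apply/funext => k; rewrite /re_series {1}x0.
congr (_ +i* _); apply: cvg_lim => //.
by have := @lim_series_finsupp R (cst 0) 0 (fun _ _ => erefl); rewrite big_ord0.
Qed.

Section multiplier.
Variables (c : nat -> R[i]) (c1 : forall k, rnorm (c k) <= 1).

Lemma multiplier_subproof x : (fun k => c k * x k) \in @ell1_pred R.
Proof using c1.
apply/ell1P; apply: series_le_cvg (@ell1_cvg R x) => k /=.
- exact: rnorm_ge0.
- exact: rnorm_ge0.
- by rewrite rnormM ler_piMl ?rnorm_ge0.
Qed.

Definition multiplier x : ell1 R := Ell1 (multiplier_subproof x).

Lemma multiplier_linear : linear multiplier.
Proof.
move=> a x y; apply: val_inj; apply/funext => k /=.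
rewrite -[LHS]/(c k * (a * x k + y k)) -[RHS]/(a * (c k * x k) + c k * y k).
by rewrite mulrDr mulrCA.
Qed.

Lemma rnorm_multiplier x : rnorm (multiplier x) <= 1 * rnorm x.
Proof.
rewrite mul1r; apply: lim_series_le; [exact: ell1_cvg|exact: ell1_cvg|].
by move=> k /=; rewrite rnormM ler_piMl ?rnorm_ge0.
Qed.

Definition blop_multiplier : blop (ell1 R) (ell1 R) :=
  mk_blop multiplier_linear rnorm_multiplier.

End multiplier.

(* The signs [c k] rotate every [v k] onto the ray of [v n], so that [c n = 1]. *)
Lemma ell1_norming v n : exists phi : blop (ell1 R) R[i]^o,
  [/\ opnorm phi <= 1, phi (e1 n) = 1 & rnorm (phi v) = rnorm v].
Proof.
pose c k := (phase (v k))^* * phase (v n).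
have c1 k : rnorm (c k) <= 1 by rewrite rnormM rnorm_conjc !rnorm_phase mul1r.
exists (blop_comp blop_ell1_sum (blop_multiplier c1)); split.
- apply: opnorm_le => x x1; apply: le_trans (rnorm_ell1_sum _) _; rewrite mul1r.
  by apply: le_trans (rnorm_multiplier _ _) _; rewrite mul1r.
- rewrite /= (_ : multiplier c1 (e1 n) = e1 n); last first.
    apply: val_inj; apply/funext => k /=; case: eqP => [->|_]; last by rewrite mulr0.
    by rewrite mulr1 /c conj_phaseM.
  rewrite ell1_sum_ge0 ?rnorm_e1// => k.
  by rewrite e1E; case: eqP => _; rewrite ?rnorm1 ?rnorm0.
- have a1 k : rnorm (phase (v k))^* <= 1 by rewrite rnorm_conjc rnorm_phase.
  rewrite /= (_ : multiplier c1 v = phase (v n) *: multiplier a1 v); last first.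
    apply: val_inj; apply/funext => k /=.
    by rewrite -[RHS]/(phase (v n) * ((phase (v k))^* * v k)) mulrA [c k]mulrC.
  rewrite -[ell1_sum _]/(blop_ell1_sum _) linearZ rnormZ rnorm_phase mul1r /=.
  have av k : multiplier a1 v k = (rnorm (v k))%:C by rewrite /= conj_phase_mul.
  rewrite ell1_sum_ge0 => [|k]; last by rewrite !av rnorm_ge0_real ?rnorm_ge0.
  rewrite rnorm_ge0_real ?rnorm_ge0//.
  rewrite -[LHS]/(ell1_norm _) -[RHS]/(ell1_norm _) /ell1_norm.
  congr (limn (series _)); apply/funext => k.
  by rewrite av rnorm_ge0_real ?rnorm_ge0.
Qed.

End norming_functional.

(** * From attained norms to attained numerical radius, and density *)

Section numerical_radius_attainment.
Context {R : realType}.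

(** Since [1 = f x] is bounded by the product of the two norms, neither norm can be below 1. *)
Lemma numPi_intro (V : normedModType R[i]) (x : V) (f : dual V) :
  rnorm x <= 1 -> opnorm f <= 1 -> f x = 1 -> numPi (x, f).
Proof.
move=> x1 f1 fx; have : 1 <= opnorm f * rnorm x.
  by have := le_opnorm f x; rewrite fx rnorm1.
have := opnorm_ge0 f; have := rnorm_ge0 x => x0 f0 fx1.
have nx : rnorm x = 1 by apply/eqP; rewrite eq_le x1/=; nra.
have nf : opnorm f = 1 by apply/eqP; rewrite eq_le f1/=; nra.
by split=> //=; rewrite rnormE ?nx// rnorm_opnorm nf.
Qed.

(** The bound [M] on [T] over the unit ball also bounds every value defining the numerical radius,
    and the state [(x, f)] reaches it. *)
Lemma attains_numerical_radius_max (V : normedModType R[i]) (T : blop V V)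
    (x : V) (f : dual V) (M : R) : numPi (x, f) -> rnorm (f (T x)) = M ->
  (forall z, rnorm z <= 1 -> rnorm (T z) <= M) -> attains_numerical_radius T.
Proof.
move=> xfPi fTx TM; exists (x, f) => //=; rewrite fTx.
have ub : ubound [set rnorm (q.2 (T q.1)) | q in numPi] M.
  move=> _ [[z g] [/= z1 g1 _] <-].
  apply: le_trans (le_opnorm _ _) _; rewrite -rnorm_opnorm {1}/rnorm g1 mul1r.
  by apply: TM; rewrite /rnorm z1.
apply/eqP; rewrite eq_le; apply/andP; split; last first.
  by apply: ge_sup => //; exists M, (x, f).
by apply: ub_le_sup; [exists M|exists (x, f)].
Qed.

Lemma dense_opnorm (V W : normedModType R[i]) (D : set (blop V W)) :
  (forall T e, 0 < e -> exists2 S, D S & opnorm (S - T) <= e) -> dense D.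
Proof.
move=> DT O [T OT] oO; have /nbhs_ballP[e /= e0 eO] := open_nbhs_nbhs (conj oO OT).
have eE : e = (complex.Re e)%:C.
  by move: e0; case: (e) => a b; rewrite ltcE/= => /andP[/eqP -> _].
have e0' : 0 < complex.Re e by move: e0; rewrite {1}eE ltcR.
(* Half the radius is used because the approximation bound is not strict while the ball is open. *)
have [S DS ST] := DT T _ (divr_gt0 e0' (ltr0Sn R 1)).
exists S; split=> //; apply: eO; rewrite -ball_normE/= distrC rnormE eE ltcR.
by rewrite rnorm_opnorm (le_lt_trans ST)// ltr_pdivrMr// ltr_pMr// ltr1n.
Qed.

Notation X := (ell1 R * c0 R)%type.

(** As a function of the [m]-th coordinate [t] alone, [S] has the form [a + t * b]. A unimodular [t]
    aligning [t * b] with [a] gives [rnorm a + rnorm b], the largest value over the disc. *)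
Lemma max_functional_unit_coord (S : dual X) n (y : c0 R) m : rnorm y <= 1 ->
  exists y' : c0 R, [/\ rnorm y' <= 1, rnorm (y' m) = 1 &
    rnorm (S (e1 n, y)) <= rnorm (S (e1 n, y'))].
Proof.
move=> y1; pose y0 := y - y m *: ec m.
pose a := S (e1 n, y0); pose b := S (0, ec m).
have SE t : S (e1 n, y0 + t *: ec m) = a + t * b.
  rewrite -[t * b]/(t *: S (0, ec m)) -linearZ -linearD.
  by rewrite -[RHS]/(S (e1 n + t *: 0, y0 + t *: ec m)) scaler0 addr0.
pose t := phase a * (phase b)^*.
have t1 : rnorm t = 1 by rewrite rnormM rnorm_conjc !rnorm_phase mul1r.
have y'E k : (y0 + t *: ec m) k = if k == m then t else y k.
  rewrite -[LHS]/(y k - y m * (k == m)%:R + t * (k == m)%:R).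
  by case: eqP => [->|_]; rewrite ?mulr1 ?subrr ?add0r// !mulr0 subr0 addr0.
exists (y0 + t *: ec m); split.
- apply/c0_norm_le => k; rewrite y'E; case: eqP => _; first by rewrite t1.
  by move/c0_norm_le: y1; apply.
- by rewrite y'E eqxx.
have -> : rnorm (S (e1 n, y0 + t *: ec m)) = rnorm a + rnorm b.
  rewrite SE /t -mulrA conj_phase_mul {1}[a]phaseE mulrC -mulrDr -rmorphD.
  by rewrite rnormM rnorm_phase mul1r rnorm_ge0_real// addr_ge0 ?rnorm_ge0.
rewrite -{1}(subrK (y m *: ec m) y) SE; apply: le_trans (rnormD _ _) _.
by rewrite lerD2l rnormM ler_piMl ?rnorm_ge0//; move/c0_norm_le: y1; apply.
Qed.

(** Only the [ell1] component is replaced, by [S]. The state at [(e1 n, y)] is a functional of norm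
    at most 1 that equals 1 at [e1 n] and norms [S (e1 n, y)]. *)
Lemma attaining_approx_ell1 (T : blop X X) (e : R) : 0 < e ->
  opnorm (blop_comp blop_snd T) <= opnorm (blop_comp blop_fst T) ->
  exists2 T' : blop X X, attains_numerical_radius T' & opnorm (T' - T) <= 5 * e.
Proof.
move=> e0 T21.
have [S [n [y [SF y1 Sge Smax]]]] := attaining_perturbation
  (blop_comp blop_fst T) (@complex_convex_ell1 R) (rnorm_e1 0) e0.
pose T' := blop_comp blop_inl S + blop_comp blop_inr (blop_comp blop_snd T).
have T'E p : T' p = (S p, (T p).2).
  by rewrite -[LHS]/(S p + 0, 0 + (T p).2) addr0 add0r.
have [phi [phi1 phin phiv]] := ell1_norming (S (e1 n, y)) n.
exists T'; last first.
  apply: opnorm_le => p p1.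
  rewrite -[(T' - T) p]/(T' p - T p) T'E -[_ - _]/(S p - (T p).1, (T p).2 - (T p).2).
  rewrite rnorm_pair_le/= subrr rnorm0 mulr_ge0 ?(ltW e0)// andbT.
  by apply: le_trans SF; exact: (le_opnorm1 (S - blop_comp blop_fst T)).
have p1 : rnorm ((e1 n, y) : X) <= 1 by rewrite rnorm_pair_le/= rnorm_e1 lexx.
have val : rnorm (blop_comp phi blop_fst (T' (e1 n, y))) = rnorm (S (e1 n, y)).
  by rewrite T'E; exact: phiv.
apply: (attains_numerical_radius_max _ val).
  apply: numPi_intro => //; apply: opnorm_le => -[u v].
  rewrite rnorm_pair_le/= => /andP[u1 _].
  by apply: le_trans phi1; exact: le_opnorm1.
move=> p pp; rewrite T'E rnorm_pair_le/= Smax//=.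
apply: le_trans (le_opnorm1 (blop_comp blop_snd T) pp) (le_trans T21 _).
by apply: le_trans Sge; rewrite lerDl ltW.
Qed.

(** Only the [m]-th coordinate of the [c0] component is replaced, by [S]. The state is the [m]-th
    coordinate functional, rotated to equal 1 at [y]. *)
Lemma attaining_approx_c0 (T : blop X X) (e : R) : 0 < e ->
  opnorm (blop_comp blop_fst T) <= opnorm (blop_comp blop_snd T) ->
  exists2 T' : blop X X, attains_numerical_radius T' & opnorm (T' - T) <= 5 * e.
Proof.
move=> e0 T12; set M2 := opnorm (blop_comp blop_snd T) in T12.
have [m mM] : exists m, M2 - e <= opnorm (blop_comp (c0_coord m) (blop_comp blop_snd T)).
  have [p p1] : exists2 p, rnorm p <= 1 & M2 - e < rnorm (T p).2.
    by apply: (opnorm_gt (f := blop_comp blop_snd T)); rewrite ltrBlDr ltrDl.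
  rewrite ltNge => /negP h; apply: contrapT => nm; apply: h.
  apply/c0_norm_le => m; rewrite leNgt; apply/negP => hm; apply: nm; exists m.
  apply: ltW; apply: lt_le_trans hm _.
  exact: (le_opnorm1 (blop_comp (c0_coord m) (blop_comp blop_snd T))).
set f := blop_comp _ _ in mM.
have [S [n [y0 [SF y01 Sge Smax0]]]] := attaining_perturbation
  f (@complex_convex_scalar R) (rnorm1 : rnorm (1 : R[i]^o) = 1) e0.
have [y [y1 ym Sy]] := max_functional_unit_coord S n m y01.
have Smax p : rnorm p <= 1 -> rnorm (S p) <= rnorm (S (e1 n, y)).
  by move=> /Smax0 h; exact: le_trans h Sy.
(* The gain [e] in [Sge] makes up for the loss [e] in choosing [m], so [S] dominates all the other
   coordinates as well. *)
have M2S : M2 <= rnorm (S (e1 n, y)) by apply: le_trans Sy; lra.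
pose T' := T + blop_comp blop_inr (blop_comp (blop_ray (ec m)) (S - f)).
have T'E p : T' p = ((T p).1, (T p).2 + (S p - (T p).2 m) *: ec m).
  by rewrite -[LHS]/((T p).1 + 0, (T p).2 + (S p - (T p).2 m) *: ec m) addr0.
have T'm p k : (T' p).2 k = if k == m then S p else (T p).2 k.
  rewrite T'E -[LHS]/((T p).2 k + (S p - (T p).2 m) * (k == m)%:R).
  by case: eqP => [->|_]; rewrite ?mulr1 ?mulr0 ?addr0// addrC subrK.
exists T'; last first.
  rewrite /T' addrAC subrr add0r; apply: le_trans SF; apply: opnorm_le => p p1.
  rewrite rnorm_pair_le/= rnorm0 opnorm_ge0/= rnormZ.
  apply: le_trans (le_opnorm1 (S - f) p1).
  by rewrite ler_piMr ?rnorm_ge0 ?rnorm_ec.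
pose phi : dual X := (y m)^* *: blop_comp (c0_coord m) blop_snd.
have phiE p : phi p = (y m)^* * p.2 m by [].
have p1 : rnorm ((e1 n, y) : X) <= 1 by rewrite rnorm_pair_le/= rnorm_e1 lexx.
have val : rnorm (phi (T' (e1 n, y))) = rnorm (S (e1 n, y)).
  by rewrite phiE rnormM rnorm_conjc ym mul1r T'm eqxx.
apply: (attains_numerical_radius_max _ val).
  apply: numPi_intro => //; last by rewrite phiE mulJc_rnorm ym expr1n.
  apply: opnorm_le => p; rewrite phiE rnormM rnorm_conjc ym mul1r.
  by rewrite rnorm_pair_le => /andP[_]; apply: le_trans; exact: le_c0_norm.
move=> p pp; rewrite rnorm_pair_le; apply/andP; split.
  rewrite T'E/=; apply: le_trans M2S; apply: le_trans T12.
  exact: (le_opnorm1 (blop_comp blop_fst T)).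
apply/c0_norm_le => k; rewrite T'm; case: eqP => _; first exact: Smax.
apply: le_trans M2S; apply: le_trans (le_c0_norm _ _) _.
exact: (le_opnorm1 (blop_comp blop_snd T)).
Qed.

End numerical_radius_attainment.

Theorem proposition3p7 (R : realType) :
  dense [set T : blop (ell1_oplus_c0 R) (ell1_oplus_c0 R) |
         attains_numerical_radius T].
Proof.
apply: dense_opnorm => T e e0.
have e5 : 0 < e / 5 by rewrite divr_gt0.
have -> : e = 5 * (e / 5) by rewrite mulrC divfK.
have [T12|/ltW T21] :=
  leP (opnorm (blop_comp blop_fst T)) (opnorm (blop_comp blop_snd T)).
  exact: attaining_approx_c0.
exact: attaining_approx_ell1.
Qed.
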